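(* Let $p(\mathbf{x}_0)$ be the data distribution on $\mathbb{R}^n$, let $t>0$ be a diffusion time with noise level $\sigma_t>0$ and $p(\mathbf{x}_t\mid\mathbf{x}_0)=\mathcal{N}(\mathbf{x}_0,\sigma_t^2\mathbf{I})$, let $\mathrm{H}\in\mathbb{R}^{m\times n}$ be a linear degradation matrix, let $\mathbf{y}\in\mathbb{R}^m$ be a measurement and $\sigma_{\mathbf{y}}^2>0$ the measurement noise variance, with $p(\mathbf{y}\mid\mathbf{x}_0)=\mathcal{N}(\mathrm{H}\mathbf{x}_0,\sigma_{\mathbf{y}}^2\mathbf{I})$. Then there is a constant $\mathrm{C}$, independent of $\mathbf{x}_t$, such that for all $\mathbf{x}_t\in\mathbb{R}^n$ the variational mode-seeking loss $\mathrm{VML}(\mathbf{x}_t,t)=D_{\mathrm{KL}}\big(p(\mathbf{x}_0\mid\mathbf{x}_t)\,\|\,p(\mathbf{x}_0\mid\mathbf{y})\big)$ equals $$-\log p(\mathbf{x}_t)-\frac{\|\mathrm{D}(\mathbf{x}_t,t)-\mathbf{x}_t\|^2}{2\sigma_t^2}-\frac{1}{2\sigma_t^2}\mathrm{Tr}\{\mathrm{Cov}[\mathbf{x}_0\mid\mathbf{x}_t]\}+\frac{\|\mathbf{y}-\mathrm{H}\mathrm{D}(\mathbf{x}_t,t)\|^2}{2\sigma_{\mathbf{y}}^2}+\frac{1}{2\sigma_{\mathbf{y}}^2}\mathrm{Tr}\{\mathrm{H}\,\mathrm{Cov}[\mathbf{x}_0\mid\mathbf{x}_t]\,\mathrm{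H}^{\top}\}+\mathrm{C}.$$
   Context: The data $\mathbf{x}_0$ has density $p(\mathbf{x}_0)$ on $\mathbb{R}^n$. In the (variance-exploding) diffusion process the noisy variable is $\mathbf{x}_t\in\mathbb{R}^n$ with conditional density $p(\mathbf{x}_t\mid\mathbf{x}_0)=\mathcal{N}(\mathbf{x}_0,\sigma_t^2\mathbf{I})$; $p(\mathbf{x}_t)=\int p(\mathbf{x}_t\mid\mathbf{x}_0)p(\mathbf{x}_0)\,d\mathbf{x}_0$ is its marginal density. By Bayes' rule $p(\mathbf{x}_0\mid\mathbf{x}_t)=p(\mathbf{x}_t\mid\mathbf{x}_0)p(\mathbf{x}_0)/p(\mathbf{x}_t)$ (the diffusion posterior) and $p(\mathbf{x}_0\mid\mathbf{y})=p(\mathbf{y}\mid\mathbf{x}_0)p(\mathbf{x}_0)/p(\mathbf{y})$ (the measurement posterior), where $p(\mathbf{y})=\int p(\mathbf{y}\mid\mathbf{x}_0)p(\mathbf{x}_0)\,d\mathbf{x}_0$. The true denoiser is $\mathrm{D}(\mathbf{x}_t,t)=\mathbb{E}[\mathbf{x}_0\mid\mathbf{x}_t]$, and $\mathrm{Cov}[\mathbf{x}_0\mid\mathbf{x}_t]$ is the covariance matrix of $p(\mathbf{x}_0\mid\mathbf{x}_t)$. $D_{\mathrm{KL}}(q\|r)=\int q\log(q/r)$. The constant $\mathrm{C}$ may depend on $t,\mathbf{y},\sigma_{\mathbf{y}},n,m$ and the data distribution. *)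

(* Defs.v *)
From HB Require Import structures.
From mathcomp Require Import all_boot all_order all_algebra.
From mathcomp Require Import all_classical all_reals all_analysis.

Set Implicit Arguments.
Unset Strict Implicit.
Unset Printing Implicit Defensive.

Import Order.TTheory GRing.Theory Num.Theory.
Import numFieldNormedType.Exports.

Local Open Scope classical_set_scope.
Local Open Scope ring_scope.

(* The sigma-algebra on R^n generated by the coordinate maps, i.e. the Borel
   sigma-algebra; the library provides it on [n.-tuple R] only. *)
Section measurable_colvec.
Context {R : realType} (n : nat).

Let coord (i : 'I_n) (x : 'cV[R]_n) : R := x i ord0.

Let colvec_set0 : g_sigma_preimage coord set0.
Proof. exact: sigma_algebra0. Qed.

Let colvec_setC A : g_sigma_preimage coord A -> g_sigma_preimage coord (~` A).
Proof. exact: sigma_algebraC. Qed.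

Let colvec_bigcup (F : (set 'cV[R]_n)^nat) :
  (forall i, g_sigma_preimage coord (F i)) ->
  g_sigma_preimage coord (\bigcup_i F i).
Proof. exact: sigma_algebra_bigcup. Qed.

HB.instance Definition _ := @isMeasurable.Build
  (measure_tuple_display default_measure_display) 'cV[R]_n
  (g_sigma_preimage coord) colvec_set0 colvec_setC colvec_bigcup.

Lemma measurable_coord (i : 'I_n) :
  measurable_fun setT (fun x : 'cV[R]_n => x i ord0 : R).
Proof.
move=> _ B mB; rewrite setTI; apply: sub_sigma_algebra => /=.
rewrite -bigcup_seq/=; exists i => /=; first by rewrite mem_index_enum.
by exists B => //; rewrite setTI.
Qed.

Lemma measurable_fun_colvec d (T : measurableType d) (f : T -> 'cV[R]_n) :
  (forall i, measurable_fun setT (fun t => f t i ord0 : R)) ->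
  measurable_fun setT f.
Proof.
move=> mf _ A mA; rewrite setTI.
suff: g_sigma_preimage coord `<=` [set B | measurable (f @^-1` B)] by exact.
apply: smallest_sub.
  split => [|B mB|F mF] /=.
  - by rewrite preimage_set0.
  - by rewrite setTD preimage_setC; exact: measurableC.
  - by rewrite preimage_bigcup; exact: bigcupT_measurable.
rewrite -bigcup_seq/=; apply: bigcup_sub => i _ B [C mC <-] /=.
rewrite setTI -[X in measurable X]setTI.
exact: mf.
Qed.

End measurable_colvec.

Section lebesgue_colvec.
Context {R : realType}.

Definition cons_cV n (p : measurableTypeR R * 'cV[R]_n) : 'cV[R]_n.+1 :=
  col_mx (p.1%:M : 'cV[R]_1) p.2.

Lemma cons_cV0 n p : @cons_cV n p ord0 ord0 = p.1.
Proof.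
have -> : (ord0 : 'I_n.+1) = lshift n (ord0 : 'I_1) by exact/val_inj.
by rewrite [LHS]col_mxEu mxE.
Qed.

Lemma cons_cVS n p (i : 'I_n) : cons_cV p (lift ord0 i) ord0 = p.2 i ord0.
Proof.
have -> : lift ord0 i = rshift 1 i :> 'I_n.+1 by exact/val_inj.
exact: col_mxEd.
Qed.

Lemma measurable_cons_cV n : measurable_fun setT (@cons_cV n).
Proof.
apply: measurable_fun_colvec => i.
have [->|[j ->]] : i = ord0 \/ exists j, i = lift ord0 j.
  by case: (unliftP ord0 i) => [j ->|->]; [right; exists j|left].
- by under eq_fun do rewrite cons_cV0; exact: measurable_fst.
- under eq_fun do rewrite cons_cVS.
  apply: (measurableT_comp (f := fun x : 'cV[R]_n => x j ord0)) => //.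
  exact: measurable_coord.
Qed.

(* Lebesgue measure on R^n, as the n-fold product of [lebesgue_measure]. *)
Fixpoint lebesgue_cV (n : nat) : set 'cV[R]_n -> \bar R :=
  match n with
  | 0 => dirac (0 : 'cV[R]_0)
  | n'.+1 => pushforward (@lebesgue_measure R \x^ @lebesgue_cV n')%E
               (@cons_cV n')
  end.

Let lebesgue_cV_measure n :
  exists m : {measure set 'cV[R]_n -> \bar R}, @lebesgue_cV n = m.
Proof.
elim: n => [|n [m mE]] /=; first by exists (dirac (0 : 'cV[R]_0)).
rewrite mE.
have mf := @measurable_cons_cV n.
pose M : {measure set _ -> \bar R} := (@lebesgue_measure R \x^ m)%E.
by unshelve eexists (pushforward M (@cons_cV n)).
Qed.

Let lebesgue_cV_set0 n : @lebesgue_cV n set0 = 0%E.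
Proof. by have [m ->] := lebesgue_cV_measure n; exact: measure0. Qed.

Let lebesgue_cV_ge0 n A : (0 <= @lebesgue_cV n A)%E.
Proof. by have [m ->] := lebesgue_cV_measure n; exact: measure_ge0. Qed.

Let lebesgue_cV_semi_sigma_additive n : semi_sigma_additive (@lebesgue_cV n).
Proof.
by have [m ->] := lebesgue_cV_measure n; exact: measure_semi_sigma_additive.
Qed.

HB.instance Definition _ n := isMeasure.Build _ _ _ (@lebesgue_cV n)
  (@lebesgue_cV_set0 n) (@lebesgue_cV_ge0 n)
  (@lebesgue_cV_semi_sigma_additive n).

Lemma lebesgue_cV_box n (B : 'I_n -> set (measurableTypeR R)) :
  (forall i, measurable (B i)) ->
  @lebesgue_cV n [set x | forall i, B i (x i ord0)] =
  (\prod_i lebesgue_measure (B i))%E.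
Proof.
elim: n B => [|n IHn] B mB.
  by rewrite big_ord0 /= diracE mem_set// => -[].
rewrite big_ord_recl -(IHn (fun i => B (lift ord0 i)))//= /pushforward.
rewrite -product_measure2E//.
  congr (product_measure2 _ _ _).
  apply/seteqP; split => [x /= Bx|x /= [B0 BS] i].
    by split => [|i]; [move: (Bx ord0)|move: (Bx (lift ord0 i))];
      rewrite ?cons_cV0 ?cons_cVS.
  by case: (unliftP ord0 i) => [j ->|->]; rewrite ?cons_cV0 ?cons_cVS.
rewrite (_ : (fun _ => _) =
    \bigcap_(i in [set: 'I_n])
      (fun x : 'cV[R]_n => x i ord0) @^-1` B (lift ord0 i)).
  apply: fin_bigcap_measurable => // i _.
  rewrite -[X in measurable X]setTI.
  by apply: (@measurable_coord R n i measurableT); exact: mB.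
by apply/seteqP; split => [x Bx i _|x Bx i]; [exact: Bx|exact: (Bx i I)].
Qed.

End lebesgue_colvec.

Arguments lebesgue_cV {R} n _.

Section densities.
Context {R : realType}.
Implicit Types n : nat.

(* The library norm [`|x|] on matrices is the sup norm, hence this one. *)
Definition norm2 n (x : 'cV[R]_n) : R := Num.sqrt (\sum_i x i ord0 ^+ 2).

Definition prob_density n (p : 'cV[R]_n -> R) : Prop :=
  [/\ measurable_fun setT p, forall x, 0 <= p x &
      (\int[lebesgue_cV n]_x (p x)%:E)%E = 1%E].

(* Density at [x] of the normal law with mean [mu] and covariance [S]. *)
Definition mvnormal_pdf n (mu : 'cV[R]_n) (S : 'M[R]_(n, n)) (x : 'cV[R]_n) :
    R :=
  (Num.sqrt ((2 * pi) ^+ n * \det S))^-1 *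
  expR (- (((x - mu)^T *m invmx S *m (x - mu)) ord0 ord0) / 2).

(* Bayes' rule, for an observation whose likelihood at [x] is [lik x]. *)
Definition evidence n (lik prior : 'cV[R]_n -> R) : R :=
  \int[lebesgue_cV n]_x (lik x * prior x).

Definition posterior n (lik prior : 'cV[R]_n -> R) (x : 'cV[R]_n) : R :=
  lik x * prior x / evidence lik prior.

Definition mean n (q : 'cV[R]_n -> R) : 'cV[R]_n :=
  \col_i \int[lebesgue_cV n]_x (x i ord0 * q x).

Definition cov n (q : 'cV[R]_n -> R) : 'M[R]_(n, n) :=
  \matrix_(i, j) \int[lebesgue_cV n]_x
    ((x i ord0 - mean q i ord0) * (x j ord0 - mean q j ord0) * q x).

(* In [\bar R], a / 0 = +oo for a > 0, 0 * +oo = 0 * -oo = 0, lne 0 = -oo and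
   lne +oo = +oo: the integrand is 0 where q = 0, and +oo where q > 0 = r. *)
Definition KL n (q r : 'cV[R]_n -> R) : \bar R :=
  (\int[lebesgue_cV n]_x ((q x)%:E * lne ((q x)%:E / (r x)%:E)))%E.

End densities.

Section diffusion.
Context {R : realType} (n m : nat).
Variables (p0 : 'cV[R]_n -> R) (sigma : R -> R).
Variables (H : 'M[R]_(m, n)) (sigma_y : R) (y : 'cV[R]_m).

(* p(x_t | x_0), as a function of x_0 *)
Definition diffusion_kernel (xt : 'cV[R]_n) (t : R) (x0 : 'cV[R]_n) : R :=
  mvnormal_pdf x0 (sigma t ^+ 2)%:M xt.

(* p(x_t) *)
Definition diffusion_marginal (xt : 'cV[R]_n) (t : R) : R :=
  evidence (diffusion_kernel xt t) p0.

(* p(x_0 | x_t) *)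
Definition diffusion_posterior (xt : 'cV[R]_n) (t : R) : 'cV[R]_n -> R :=
  posterior (diffusion_kernel xt t) p0.

(* p(y | x_0), as a function of x_0 *)
Definition measurement_likelihood (x0 : 'cV[R]_n) : R :=
  mvnormal_pdf (H *m x0) (sigma_y ^+ 2)%:M y.

(* p(x_0 | y) *)
Definition measurement_posterior : 'cV[R]_n -> R :=
  posterior measurement_likelihood p0.

Definition denoiser (xt : 'cV[R]_n) (t : R) : 'cV[R]_n :=
  mean (diffusion_posterior xt t).

Definition diffusion_cov (xt : 'cV[R]_n) (t : R) : 'M[R]_(n, n) :=
  cov (diffusion_posterior xt t).

Definition VML (xt : 'cV[R]_n) (t : R) : \bar R :=
  KL (diffusion_posterior xt t) measurement_posterior.

End diffusion.

(* Main.v *)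
(* Taking the logarithm of the ratio of the two posteriors cancels the prior and
   leaves two quadratic functions of [x_0] plus the normalizing constants, of
   which only [p(x_t)] depends on [x_t]. The expectation of [|a - M x_0|^2] under
   the diffusion posterior is [|a - M D|^2 + Tr (M Cov M^T)], used with
   [M = I, a = x_t] and [M = H, a = y]. The second
   moments exist, whatever the data distribution, because
   [|x_t - x_0|^2 p(x_t | x_0)] is bounded in [x_0]. *)

Require Import Defs.
From mathcomp Require Import all_boot all_order all_algebra.
From mathcomp Require Import all_classical all_reals all_analysis.
From mathcomp Require Import measurable_realfun ring lra.

Set Implicit Arguments.
Unset Strict Implicit.
Unset Printing Implicit Defensive.

Import Order.TTheory GRing.Theory Num.Theory.
Local Open Scope ring_scope.

(** * Means and second moments against a nonnegative weight [q] *)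

Section moments.
Context d (T : measurableType d) (R : realType).
Variable mu : {measure set T -> \bar R}.
Variable q : T -> R.
Hypotheses (mq : measurable_fun setT q) (q_ge0 : forall x, 0 <= q x).
Implicit Types f g : T -> R.

(** Integrability is bundled with the value: the real-valued integral takes a default value when the
    integral is infinite, and its linearity needs integrable summands. [q] is only a weight; total
    mass 1 is expressed by [has_mean (cst 1) 1]. *)
Definition has_mean f (v : R) : Prop :=
  mu.-integrable setT (EFin \o (fun x => f x * q x)) /\
  \int[mu]_x (f x * q x) = v.

Lemma has_meanE f g v w : has_mean f v -> f =1 g -> v = w -> has_mean g w.
Proof. by move=> fv /funext <- <-. Qed.

Lemma has_meanD f g v w :
  has_mean f v -> has_mean g w -> has_mean (fun x => f x + g x) (v + w).
Proof.
move=> [fi <-] [gi <-]; rewrite /has_mean.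
split.
  by apply: eq_integrable (integrableD _ fi gi) => // x _ /=; rewrite mulrDl EFinD.
by under eq_Rintegral do rewrite mulrDl; rewrite RintegralD.
Qed.

Lemma has_meanZ k f v : has_mean f v -> has_mean (fun x => k * f x) (k * v).
Proof.
move=> [fi <-]; split.
  by apply: eq_integrable (integrableZl _ k fi) => // x _ /=; rewrite -mulrA EFinM.
by under eq_Rintegral do rewrite -mulrA; rewrite RintegralZl.
Qed.

Lemma has_mean_sum n (f : 'I_n -> T -> R) v :
  (forall i, has_mean (f i) (v i)) ->
  has_mean (fun x => \sum_i f i x) (\sum_i v i).
Proof.
elim: n f v => [|n IHn] f v fv.
  have -> : (fun x => \sum_i f i x) = cst 0 by apply/funext => x; rewrite big_ord0.
  rewrite big_ord0; split.
    by apply: eq_integrable (integrable0 mu setT) => // x _ /=; rewrite mul0r.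
  by under eq_Rintegral do rewrite mul0r; rewrite Rintegral_cst// mul0r.
have h := has_meanD (fv ord0) (IHn _ _ (fun i => fv (lift ord0 i))).
by apply: has_meanE h _ _ => [x|]; rewrite big_ord_recl.
Qed.

(** Measurability of [f] is recorded separately because [f x ^+ 2] forgets the sign of [f], while
    products [f x * g x] must be measurable. *)
Definition square_integrable f : Prop :=
  measurable_fun setT f /\
  mu.-integrable setT (EFin \o (fun x => f x ^+ 2 * q x)).

(** Paired with [square_integrableM], this turns second moments into first moments. *)
Lemma square_integrable1 : has_mean (cst 1) 1 -> square_integrable (cst 1).
Proof.
move=> [q_int _]; split; first exact: measurable_cst.
by apply: eq_integrable q_int => // x _ /=; rewrite expr1n.
Qed.

(* [2 |f g| <= f^2 + g^2] *)
Lemma square_integrableM f g : square_integrable f -> square_integrable g ->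
  mu.-integrable setT (EFin \o (fun x => f x * g x * q x)).
Proof.
move=> [mf fi] [mg gi].
apply: le_integrable (integrableD _ fi gi) => //.
  by apply/measurable_EFinP; apply: measurable_funM => //; exact: measurable_funM.
move=> x _ /=; rewrite lee_fin -mulrDl !normrM (ger0_norm (q_ge0 x)).
rewrite ler_wpM2r// (ger0_norm (addr_ge0 (sqr_ge0 _) (sqr_ge0 _))).
rewrite -(real_normK (num_real (f x))) -(real_normK (num_real (g x))).
by have := sqr_ge0 (`|f x| - `|g x|); have := sqr_ge0 (`|f x| + `|g x|); nra.
Qed.

Lemma square_integrableD f g : square_integrable f -> square_integrable g ->
  square_integrable (fun x => f x + g x).
Proof.
move=> Lf Lg; split; first by apply: measurable_funD; [case: Lf|case: Lg].
have fg := square_integrableM Lf Lg.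
(* The cross term is added twice to produce the [2 f g] of the expanded square. *)
have := integrableD measurableT (integrableD measurableT (proj2 Lf) (proj2 Lg))
  (integrableD measurableT fg fg).
by apply: eq_integrable => // x _ /=; rewrite -!EFinD; congr EFin; ring.
Qed.

Lemma square_integrableZ k f :
  square_integrable f -> square_integrable (fun x => k * f x).
Proof.
move=> [mf fi]; split; first exact: measurable_funM.
have := integrableZl measurableT (k ^+ 2) fi.
by apply: eq_integrable => // x _ /=; rewrite -!EFinM; congr EFin; ring.
Qed.

End moments.

(** * Mean squared distance from a point to an affine image *)

Section affine_moments.
Context {R : realType} (n : nat).
Implicit Types (q : 'cV[R]_n -> R).

Lemma norm2_sqr k (x : 'cV[R]_k) : norm2 x ^+ 2 = \sum_i x i ord0 ^+ 2.
Proof. by rewrite sqr_sqrtr// sumr_ge0// => i _; exact: sqr_ge0. Qed.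

Lemma norm2_mul k (x : 'cV[R]_k) : norm2 x ^+ 2 = (x^T *m x) ord0 ord0.
Proof.
by rewrite norm2_sqr mxE; apply: eq_bigr => i _; rewrite mxE expr2.
Qed.

Lemma norm2N k (x : 'cV[R]_k) : norm2 (- x) = norm2 x.
Proof. by congr Num.sqrt; apply: eq_bigr => i _; rewrite mxE sqrrN. Qed.

(* Expand around the mean: the linear term vanishes. *)
Lemma has_mean_norm2_affine q k (a : 'cV[R]_k) (M : 'M[R]_(k, n)) :
    measurable_fun setT q -> (forall x, 0 <= q x) ->
    has_mean (lebesgue_cV n) q (cst 1) 1 ->
    (forall i, square_integrable (lebesgue_cV n) q (fun x => x i ord0)) ->
  has_mean (lebesgue_cV n) q (fun x => norm2 (a - M *m x) ^+ 2)
    (norm2 (a - M *m mean q) ^+ 2 + \tr (M *m cov q *m M^T)).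
Proof.
move=> mq q_ge0 q1 Lx; set D := mean q; set b := a - M *m D.
pose c (i : 'I_n) (x : 'cV[R]_n) : R := x i ord0 - D i ord0.
have L1 := square_integrable1 q1.
have mean_x i : has_mean (lebesgue_cV n) q (fun x => x i ord0) (D i ord0).
  split; last by rewrite mxE.
  have := square_integrableM mq q_ge0 (Lx i) L1.
  by apply: eq_integrable => // x _ /=; rewrite mulr1.
have mean_c i : has_mean (lebesgue_cV n) q (c i) 0.
  apply: has_meanE (has_meanD (mean_x i) (has_meanZ (- D i ord0) q1)) _ _.
    by move=> x /=; rewrite mulr1.
  by rewrite mulr1 subrr.
have Lc i : square_integrable (lebesgue_cV n) q (c i).
  have := square_integrableD mq q_ge0 (Lx i) (square_integrableZ (- D i ord0) L1).
  by under eq_fun do rewrite /= mulr1.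
have mean_cc i j : has_mean (lebesgue_cV n) q (fun x => c i x * c j x) (cov q i j).
  by split; [exact: square_integrableM|rewrite mxE].
(* Writing [x = D + c] gives [a - M x = b - M c] with [c] centred, so each squared coordinate splits
   into a constant, a linear part of mean 0 and a quadratic part in the covariances. *)
have affE x i : (a - M *m x) i ord0 = b i ord0 - \sum_j M i j * c j x.
  rewrite /b !mxE -addrA -opprD -big_split /=; congr (_ - _).
  by apply: eq_bigr => j _; rewrite /c; ring.
have mean_row i : has_mean (lebesgue_cV n) q (fun x => (a - M *m x) i ord0 ^+ 2)
    (b i ord0 ^+ 2 + \sum_j \sum_l M i j * (M i l * cov q j l)).
  have hlin := has_mean_sum (fun j => has_meanZ (M i j) (mean_c j)).
  have hquad := has_mean_sum (fun j => has_mean_sum (fun l =>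
    has_meanZ (M i j) (has_meanZ (M i l) (mean_cc j l)))).
  apply: has_meanE (has_meanD (has_meanD (has_meanZ (b i ord0 ^+ 2) q1)
    (has_meanZ (- 2 * b i ord0) hlin)) hquad) _ _ => [x|].
    rewrite affE /= mulr1.
    have -> : \sum_j \sum_l M i j * (M i l * (c j x * c l x)) =
        (\sum_j M i j * c j x) ^+ 2.
      rewrite expr2 mulr_suml; apply: eq_bigr => j _.
      by rewrite mulr_sumr; apply: eq_bigr => l _; ring.
    by ring.
  by rewrite mulr1 [X in _ * X]big1 ?mulr0 ?addr0// => j _; rewrite mulr0.
apply: has_meanE (has_mean_sum mean_row) _ _ => [x|]; first by rewrite norm2_sqr.
rewrite big_split /= norm2_sqr; congr (_ + _).
(* The diagonal entry of [M Cov M^T] sums over [l] outside and [j] inside, hence the exchange. *)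
apply: eq_bigr => i _; rewrite mxE exchange_big /=; apply: eq_bigr => l _.
by rewrite !mxE mulr_suml; apply: eq_bigr => j _; ring.
Qed.

End affine_moments.

(** * Isotropic Gaussian densities: explicit form, bounds, measurability *)

Section gaussian_likelihood.
Context {R : realType} (n : nat).
Implicit Types (p lik : 'cV[R]_n -> R).

(** The normalizing factor of the normal law with covariance [v I] in dimension [k]. It is also the
    maximum of the density, and so serves as the bound on the likelihoods. *)
Definition normal_const k (v : R) : R := (Num.sqrt ((2 * pi) ^+ k * v ^+ k))^-1.

Lemma normal_const_gt0 k v : 0 < v -> 0 < normal_const k v.
Proof.
by move=> v0; rewrite invr_gt0 sqrtr_gt0 mulr_gt0// exprn_gt0// mulr_gt0// pi_gt0.
Qed.

Lemma mvnormal_pdf_scalar k (mu x : 'cV[R]_k) v :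
  mvnormal_pdf mu v%:M x =
  normal_const k v * expR (- (norm2 (x - mu) ^+ 2 / (2 * v))).
Proof.
rewrite /mvnormal_pdf det_scalar invmx_scalar; congr (_ * expR _).
rewrite mul_mx_scalar -scalemxAl mxE -norm2_mul invfM.
by ring.
Qed.

Lemma mvnormal_pdf_gt0 k (mu x : 'cV[R]_k) v :
  0 < v -> 0 < mvnormal_pdf mu v%:M x.
Proof.
by move=> v0; rewrite mvnormal_pdf_scalar mulr_gt0 ?normal_const_gt0 ?expR_gt0.
Qed.

Lemma mvnormal_pdf_le k (mu x : 'cV[R]_k) v :
  0 < v -> mvnormal_pdf mu v%:M x <= normal_const k v.
Proof.
move=> v0; rewrite mvnormal_pdf_scalar ger_pMr ?normal_const_gt0//.
by rewrite -expR0 ler_expR oppr_le0 divr_ge0 ?sqr_ge0// mulr_ge0// ltW.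
Qed.

(* [w <= e ^ w] at [w = |x - mu|^2 / (2 v)] *)
Lemma norm2_mvnormal_pdf_le k (mu x : 'cV[R]_k) v : 0 < v ->
  norm2 (x - mu) ^+ 2 * mvnormal_pdf mu v%:M x <= 2 * v * normal_const k v.
Proof.
move=> v0; rewrite mvnormal_pdf_scalar.
set w := norm2 _ ^+ 2 / _.
have -> : norm2 (x - mu) ^+ 2 = 2 * v * w by rewrite /w; field; rewrite gt_eqF.
have -> : 2 * v * w * (normal_const k v * expR (- w)) =
    2 * v * normal_const k v * (w * expR (- w)) by ring.
rewrite ler_piMr ?mulr_ge0 ?(ltW (normal_const_gt0 k v0)) ?(ltW v0)//.
rewrite expRN ler_pdivrMr ?expR_gt0// mul1r.
by rewrite (le_trans _ (expR_ge1Dx w))// lerDr.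
Qed.

Lemma measurable_affine_norm2 k (a : 'cV[R]_k) (M : 'M[R]_(k, n)) :
  measurable_fun setT (fun x : 'cV[R]_n => norm2 (a - M *m x) ^+ 2).
Proof.
under eq_fun do rewrite norm2_sqr.
apply: measurable_sum => i; apply: measurable_funX.
under eq_fun do rewrite !mxE.
apply: measurable_funB; first exact: measurable_cst.
apply: measurable_sum => j; apply: measurable_funM; first exact: measurable_cst.
exact: measurable_coord.
Qed.

Lemma measurable_mvnormal_pdf_affine k (a : 'cV[R]_k) (M : 'M[R]_(k, n)) v :
  measurable_fun setT (fun x : 'cV[R]_n => mvnormal_pdf (M *m x) v%:M a).
Proof.
under eq_fun do rewrite mvnormal_pdf_scalar.
apply: measurable_funM; first exact: measurable_cst.
apply: (measurableT_comp (f := expR)) => //.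
apply: measurable_funN.
apply: measurable_funM; last exact: measurable_cst.
exact: measurable_affine_norm2.
Qed.

(** * Bounded likelihoods: evidence, posterior and relative entropy *)

Lemma integrable_bounded_density p (f : 'cV[R]_n -> R) B :
    prob_density p -> measurable_fun setT f -> (forall x, `|f x| <= B) ->
  (lebesgue_cV n).-integrable setT (EFin \o (fun x => f x * p x)).
Proof.
move=> [mp p_ge0 p1] mf fB.
have pi : (lebesgue_cV n).-integrable setT (EFin \o p).
  apply/integrableP; split; first exact/measurable_EFinP.
  by under eq_integral do rewrite /= ger0_norm//; rewrite p1 ltry.
apply: le_integrable (integrableZl _ B pi) => //.
  by apply/measurable_EFinP; exact: measurable_funM.
move=> x _; rewrite /= lee_fin !normrM ler_wpM2r//.
exact: le_trans (fB x) (ler_norm B).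
Qed.

(** If the evidence were 0, then [lik * p] would vanish almost everywhere; since [lik] is positive,
    so would [p], contradicting its total mass 1. *)
Lemma evidence_gt0 p lik B :
    prob_density p -> measurable_fun setT lik ->
    (forall x, 0 < lik x) -> (forall x, lik x <= B) ->
  0 < evidence lik p.
Proof.
move=> pd mlik lik_gt0 likB; have [mp p_ge0 p1] := pd.
have fi : (lebesgue_cV n).-integrable setT (EFin \o (fun x => lik x * p x)).
  by apply: (@integrable_bounded_density _ _ B) => // x; rewrite gtr0_norm.
rewrite lt_neqAle Rintegral_ge0 ?andbT; last first.
  by move=> x _; rewrite mulr_ge0// ltW.
apply/negP => /eqP Z0.
have : (\int[lebesgue_cV n]_x `|(lik x * p x)%:E| = 0)%E.
  under eq_integral do rewrite gee0_abs ?lee_fin ?mulr_ge0 ?(ltW (lik_gt0 _))//.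
  (* [Z0] concerns the real-valued integral; integrability transfers it to the extended reals. *)
  by rewrite -[LHS]fineK ?integrable_fin_num// -[fine _]/(evidence lik p) -Z0.
move/ae_eq_integral_abs => /(_ measurableT).
have mf : measurable_fun setT (fun x => (lik x * p x)%:E).
  by apply/measurable_EFinP; exact: measurable_funM.
move=> /(_ mf) ae0.
have : (\int[lebesgue_cV n]_x (p x)%:E = 0)%E.
  rewrite (ae_eq_integral (cst 0%E)) ?integral0//; first exact/measurable_EFinP.
  apply: filterS ae0 => x /= /(_ I) [/eqP]; rewrite mulf_eq0 gt_eqF//= => /eqP ->.
  by [].
by rewrite p1 => -[] /eqP; rewrite oner_eq0.
Qed.

Lemma has_mean_posterior_cst p lik B :
    prob_density p -> measurable_fun setT lik ->
    (forall x, 0 < lik x) -> (forall x, lik x <= B) ->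
  has_mean (lebesgue_cV n) (posterior lik p) (cst 1) 1.
Proof.
move=> pd mlik lik_gt0 likB.
have Z_gt0 := evidence_gt0 pd mlik lik_gt0 likB.
have fi : (lebesgue_cV n).-integrable setT (EFin \o (fun x => lik x * p x)).
  by apply: (@integrable_bounded_density _ _ B) => // x; rewrite gtr0_norm.
have postE x : 1 * posterior lik p x = (evidence lik p)^-1 * (lik x * p x).
  by rewrite mul1r mulrC.
split.
  have := integrableZl measurableT (evidence lik p)^-1 fi.
  by apply: eq_integrable => // x _; rewrite /= postE.
under eq_Rintegral do rewrite /cst postE.
by rewrite RintegralZl// mulVf// gt_eqF.
Qed.

(* The ratio of the posteriors cancels the prior, except where it vanishes:
   there both integrands are [0] by the conventions for [lne] and division. *)
Lemma KL_posterior p lik1 lik2 v :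
    (forall x, 0 <= p x) ->
    (forall x, 0 < lik1 x) -> (forall x, 0 < lik2 x) ->
    0 < evidence lik1 p -> 0 < evidence lik2 p ->
    has_mean (lebesgue_cV n) (posterior lik1 p)
      (fun x => ln (lik1 x) - ln (lik2 x) - ln (evidence lik1 p)
                + ln (evidence lik2 p)) v ->
  KL (posterior lik1 p) (posterior lik2 p) = v%:E.
Proof.
move=> p_ge0 l1 l2 Z1 Z2 [fi <-].
(* By integrability the real integral equals the extended one, so it remains to compare integrands
   pointwise. *)
rewrite -[RHS]/((fine _)%:E) fineK ?integrable_fin_num//.
apply: eq_integral => x _.
have [p0|p0] := eqVneq (p x) 0.
  by rewrite /posterior p0 !(mulr0, mul0r) mul0e.
have {}p0 : 0 < p x by rewrite lt_neqAle eq_sym p0 p_ge0.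
(* Where the prior is positive so are both posteriors, and the extended quotient and [lne] reduce to
   real division and [ln]. *)
have r0 : 0 < posterior lik2 p x by rewrite divr_gt0 ?mulr_gt0.
have q0 : 0 < posterior lik1 p x by rewrite divr_gt0 ?mulr_gt0.
rewrite inver ifF ?gt_eqF//.
have -> : lne ((posterior lik1 p x)%:E * ((posterior lik2 p x)^-1)%:E)%E =
    (ln (posterior lik1 p x / posterior lik2 p x))%:E.
  by rewrite -lne_EFin//; exact: divr_gt0.
rewrite [RHS]EFinM [RHS]muleC; congr (_ * _%:E)%E.
rewrite /posterior !(ln_div, lnM) ?posrE ?divr_gt0 ?mulr_gt0//.
by ring.
Qed.

End gaussian_likelihood.

(** * Decomposition of the variational mode-seeking loss *)

Theorem proposition3p2 (R : realType) (n m : nat) (p0 : 'cV[R]_n -> R)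
    (p0_density : prob_density p0)
    (sigma : R -> R) (t : R) (t_gt0 : 0 < t) (sigma_t_gt0 : 0 < sigma t)
    (H : 'M[R]_(m, n)) (y : 'cV[R]_m)
    (sigma_y : R) (sigma_y2_gt0 : 0 < sigma_y ^+ 2) :
  exists C : R, forall xt : 'cV[R]_n,
    let D := denoiser p0 sigma xt t in
    let Cov := diffusion_cov p0 sigma xt t in
    VML p0 sigma H sigma_y y xt t =
    (- ln (diffusion_marginal p0 sigma xt t)
     - norm2 (D - xt) ^+ 2 / (2 * sigma t ^+ 2)
     - (2 * sigma t ^+ 2)^-1 * \tr Cov
     + norm2 (y - H *m D) ^+ 2 / (2 * sigma_y ^+ 2)
     + (2 * sigma_y ^+ 2)^-1 * \tr (H *m Cov *m H^T)
     + C)%:E.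

Proof.
set v := sigma t ^+ 2; set w := sigma_y ^+ 2.
have v0 : 0 < v by rewrite exprn_gt0.
have [mp p_ge0 _] := p0_density.
set lik2 := measurement_likelihood H sigma_y y.
have mlik2 : measurable_fun setT lik2 by exact: measurable_mvnormal_pdf_affine.
have lik2_gt0 x : 0 < lik2 x by exact: mvnormal_pdf_gt0.
have lik2_le x : lik2 x <= normal_const m w by exact: mvnormal_pdf_le.
have Z2_gt0 := evidence_gt0 p0_density mlik2 lik2_gt0 lik2_le.
(* The logarithms of the two Gaussian normalizing factors, and [log p(y)]: everything in the
   log-ratio that depends on neither [x_0] nor [x_t]. *)
exists (ln (normal_const n v) - ln (normal_const m w) + ln (evidence lik2 p0)).
move=> xt D Cov.
set lik1 := diffusion_kernel sigma xt t.
have mlik1 : measurable_fun setT lik1.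
  have := measurable_mvnormal_pdf_affine xt 1%:M v.
  by under eq_fun do rewrite mul1mx.
have lik1_gt0 x : 0 < lik1 x by exact: mvnormal_pdf_gt0.
have lik1_le x : lik1 x <= normal_const n v by exact: mvnormal_pdf_le.
have Z1_gt0 := evidence_gt0 p0_density mlik1 lik1_gt0 lik1_le.
set q := posterior lik1 p0.
have mq : measurable_fun setT q.
  by apply: measurable_funM => //; exact: measurable_funM.
have q_ge0 x : 0 <= q x.
  by apply: divr_ge0; [apply: mulr_ge0 => //|]; exact: ltW.
have q1 := has_mean_posterior_cst p0_density mlik1 lik1_gt0 lik1_le.
have L1 := square_integrable1 q1.
(* The kernel controls the second moment about [xt]; adding back the constant [xt i ord0], which is
   square integrable since [q] has mass 1, gives the one about 0. *)
have Lx i : square_integrable (lebesgue_cV n) q (fun x => x i ord0).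
  have Ld : square_integrable (lebesgue_cV n) q (fun x => x i ord0 - xt i ord0).
    have md : measurable_fun setT (fun x : 'cV[R]_n => x i ord0 - xt i ord0).
      by apply: measurable_funB; [exact: measurable_coord|exact: measurable_cst].
    split=> //.
    have mf : measurable_fun setT
        (fun x : 'cV[R]_n => (x i ord0 - xt i ord0) ^+ 2 * lik1 x).
      by apply: measurable_funM => //; exact: measurable_funX.
    have fB (x : 'cV[R]_n) :
          `|(x i ord0 - xt i ord0) ^+ 2 * lik1 x| <= 2 * v * normal_const n v.
      rewrite (ger0_norm (mulr_ge0 (sqr_ge0 _) (ltW (lik1_gt0 x)))).
      (* The squared coordinate is one term of [norm2 (xt - x) ^+ 2]. *)
      apply: le_trans (norm2_mvnormal_pdf_le x xt v0).
      rewrite ler_pM2r// norm2_sqr (bigD1 i)//= !mxE -sqrrN opprB lerDl.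
      by rewrite sumr_ge0// => j _; exact: sqr_ge0.
    have := integrableZl measurableT (evidence lik1 p0)^-1
      (integrable_bounded_density p0_density mf fB).
    apply: eq_integrable => // x _; rewrite /= -EFinM; congr EFin.
    by rewrite /q /posterior; ring.
  have := square_integrableD mq q_ge0 Ld (square_integrableZ (xt i ord0) L1).
  by under eq_fun do rewrite /= mulr1 subrK.
have hy := has_mean_norm2_affine y H mq q_ge0 q1 Lx.
have hx := has_mean_norm2_affine xt 1%:M mq q_ge0 q1 Lx.
rewrite trmx1 mulmx1 !mul1mx -norm2N opprB in hx.
apply: KL_posterior => //.
(* The part of the log-ratio free of [x_0]: the constant already chosen, minus [log p(x_t)]. *)
pose K := ln (normal_const n v) - ln (normal_const m w) - ln (evidence lik1 p0)
  + ln (evidence lik2 p0).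
(* The coefficients are those of the Gaussian exponents; the second changes sign because
   [ln (lik2 x)] is subtracted. *)
apply: has_meanE (has_meanD (has_meanD (has_meanZ (- (2 * v)^-1) hx)
  (has_meanZ (2 * w)^-1 hy)) (has_meanZ K q1)) _ _ => [x|].
  rewrite /lik1 /lik2 /diffusion_kernel /measurement_likelihood.
  rewrite !mvnormal_pdf_scalar !lnM ?posrE ?expR_gt0 ?normal_const_gt0// !expRK.
  by rewrite mul1mx /K /cst; ring.
by rewrite /K -/q -/D -/Cov; ring.
Qed.
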